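(* For a finite simple graph $G$ the following statements are equivalent: (1) $G$ admits a $\{{}^bP_3,{}^rP_3,{}^bK_3,{}^rK_3\}$-free $2$-edge-colouring. (2) Each connected component of $G$ is an induced subgraph of either $K_5$, the diamond, an even cycle, or an $n$-butterfly for some $n\ge 0$. (3) $G$ is a $\{\text{odd-hole}, \text{claw}, \text{house}, \text{bull}, \text{gem}, 4\text{-wheel}, \text{kite}, X_1, X_2, K_4+l, K_5-e, K_6\}$-free graph.
   Context: Graphs are finite and simple. A $2$-edge-colouring of $G$ assigns to every edge the colour red or blue (not necessarily properly). For a set $\mathcal F$ of $2$-edge-coloured graphs, a $2$-edge-colouring of $G$ is $\mathcal F$-free if no induced $2$-edge-coloured subgraph is isomorphic (preserving colours) to a member of $\mathcal F$. Patterns on three vertices: ${}^rP_3$ (resp. ${}^bP_3$) is the path on three vertices with both edges red (resp. blue); ${}^rK_3$ (resp. ${}^bK_3$) is the triangle with all edges red (resp. blue). For uncoloured graphs, being free of a set of graphs means containing no induced subgraph isomorphic to a member. Claw: $K_{1,3}$. Diamond: $K_4$ minus an edge. House: $C_4$ plus a new vertex adjacent to exactly two adjacent vertices of the $C_4$. Bull: a triangle plus two new non-adjacent vertices, each adjacent to exactly one vertex of the triangle, these two triangle vertices being distinct. $4$-wheel: join of $C_4$ and $K_1$. Gem: join of $P_4$ and $K_1$. Kite: diamond plus a new vertex adjacent to exactly one vertex of the diamond, which has degree $2$ in the diamond. $X_1$: diamond plus a new vertex adjacent to exactly the two vertices of degree $2$ of the diamond. $X_2$: diamond plus a new vertex adjacent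 to both vertices of degree $3$ and to exactly one vertex of degree $2$ of the diamond. $K_4+l$: $K_4$ plus a new vertex adjacent to exactly one vertex of the $K_4$. $K_5-e$: $K_5$ minus one edge. An odd-hole is a chordless cycle of odd length at least $5$; an even cycle is a cycle $C_{2m}$ with $m\ge 2$. For $n\ge 0$, the $n$-butterfly consists of two triangles joined by a path of length $n$ (one vertex of each triangle is an end of the path; for $n=0$ the two triangles share exactly one vertex). *)

(* Defs.v *)
From mathcomp Require Import all_boot.
Set Implicit Arguments.
Unset Strict Implicit.
Unset Printing Implicit Defensive.

Record sgraph := SGraph {
  svertex :> finType;
  sedge : rel svertex;
  sedge_sym : symmetric sedge;
  sedge_irr : irreflexive sedge }.

(* The relation r need neither be symmetric nor irreflexive: each edge may be
   listed in one direction only. *)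
Section SimpleGraph.
Variables (T : finType) (r : rel T).

Definition simple_rel : rel T := [rel x y | (x != y) && (r x y || r y x)].

Lemma simple_rel_sym : symmetric simple_rel.
Proof. by move=> x y; rewrite /simple_rel /= eq_sym orbC. Qed.

Lemma simple_rel_irr : irreflexive simple_rel.
Proof. by move=> x; rewrite /simple_rel /= eqxx. Qed.

Definition simple_graph := SGraph simple_rel_sym simple_rel_irr.
End SimpleGraph.

Section Induced.
Variables (G : sgraph) (S : {set G}).

Definition induced_rel : rel {x : G | x \in S} :=
  [rel x y | sedge (val x) (val y)].

Lemma induced_rel_sym : symmetric induced_rel.
Proof. by move=> x y; rewrite /induced_rel /= sedge_sym. Qed.

Lemma induced_rel_irr : irreflexive induced_rel.
Proof. by move=> x; rewrite /induced_rel /= sedge_irr. Qed.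

Definition induced := SGraph induced_rel_sym induced_rel_irr.
End Induced.

Definition sg_iso (G H : sgraph) : Prop :=
  exists2 f : G -> H, bijective f & forall x y, sedge (f x) (f y) = sedge x y.

Definition induced_subgraph_of (H G : sgraph) : Prop :=
  exists S : {set G}, sg_iso (induced S) H.

Definition free (F : sgraph -> Prop) (G : sgraph) : Prop :=
  forall H, F H -> ~ induced_subgraph_of H G.

Definition components (G : sgraph) : {set {set G}} :=
  equivalence_partition (connect (@sedge G)) [set: G].

Inductive colour := Red | Blue.

(* The edge xy is the set [set x; y]; the values of the colouring on sets that
   are not edges carry no information, and cg_iso ignores them. *)
Record cgraph := CGraph {
  cg_graph :> sgraph;
  cg_colour : {set cg_graph} -> colour }.

Definition cg_induced (G : cgraph) (S : {set G}) : cgraph :=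
  @CGraph (induced S) (fun e => cg_colour (val @: e)).

Definition cg_iso (G H : cgraph) : Prop :=
  exists f : G -> H,
    [/\ bijective f,
        forall x y, sedge (f x) (f y) = sedge x y
      & forall x y, sedge x y ->
          cg_colour [set f x; f y] = cg_colour [set x; y]].

Definition cg_free (F : cgraph -> Prop) (G : cgraph) : Prop :=
  forall H, F H -> ~ exists S : {set G}, cg_iso (cg_induced S) H.

Definition complete_graph (n : nat) : sgraph :=
  simple_graph (fun i j : 'I_n => i != j).

(* The cycle C_n for n >= 3. *)
Definition cycle_graph (n : nat) : sgraph :=
  simple_graph (fun i j : 'I_n => j == i.+1 %% n :> nat).

(* The two triangles are {0, 1, 2} and {n+2, n+3, n+4}; the joining path is
   2, 3, ..., n+2. *)
Definition butterfly (n : nat) : sgraph :=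
  simple_graph (fun i j : 'I_(n + 5) =>
    [|| j == i.+1 :> nat,
        (i == 0 :> nat) && (j == 2 :> nat)
      | (i == n + 2 :> nat) && (j == n + 4 :> nat)]).

Definition graph_on (n : nat) (s : seq (nat * nat)) : sgraph :=
  simple_graph (fun i j : 'I_n => (nat_of_ord i, nat_of_ord j) \in s).

Definition P3_edges := [:: (0, 1); (1, 2)].
Definition P4_edges := [:: (0, 1); (1, 2); (2, 3)].
Definition C4_edges := [:: (0, 1); (1, 2); (2, 3); (3, 0)].
Definition K3_edges := [:: (0, 1); (0, 2); (1, 2)].
(* Vertices 0 and 1 have degree 3, vertices 2 and 3 have degree 2. *)
Definition diamond_edges := [:: (0, 1); (0, 2); (0, 3); (1, 2); (1, 3)].
Definition K4_edges := (2, 3) :: diamond_edges.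

Definition P3 := graph_on 3 P3_edges.
Definition claw := graph_on 4 [:: (0, 1); (0, 2); (0, 3)].
Definition diamond := graph_on 4 diamond_edges.
Definition house := graph_on 5 (C4_edges ++ [:: (0, 4); (1, 4)]).
Definition bull := graph_on 5 (K3_edges ++ [:: (0, 3); (1, 4)]).
Definition wheel4 :=
  graph_on 5 (C4_edges ++ [:: (0, 4); (1, 4); (2, 4); (3, 4)]).
Definition gem :=
  graph_on 5 (P4_edges ++ [:: (0, 4); (1, 4); (2, 4); (3, 4)]).
Definition kite := graph_on 5 (diamond_edges ++ [:: (2, 4)]).
Definition X1 := graph_on 5 (diamond_edges ++ [:: (2, 4); (3, 4)]).
Definition X2 := graph_on 5 (diamond_edges ++ [:: (0, 4); (1, 4); (2, 4)]).
Definition K4_plus_l := graph_on 5 (K4_edges ++ [:: (0, 4)]).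
(* The missing edge is {3, 4}. *)
Definition K5_minus_e :=
  graph_on 5 (K4_edges ++ [:: (0, 4); (1, 4); (2, 4)]).

Definition monochromatic (k : colour) (G : sgraph) : cgraph :=
  @CGraph G (fun=> k).

Inductive mono_P3_K3 : cgraph -> Prop :=
| Mono_bP3 : mono_P3_K3 (monochromatic Blue P3)
| Mono_rP3 : mono_P3_K3 (monochromatic Red P3)
| Mono_bK3 : mono_P3_K3 (monochromatic Blue (complete_graph 3))
| Mono_rK3 : mono_P3_K3 (monochromatic Red (complete_graph 3)).

Inductive forbidden : sgraph -> Prop :=
| Forbid_odd_hole n : odd n -> 5 <= n -> forbidden (cycle_graph n)
| Forbid_claw : forbidden claw
| Forbid_house : forbidden house
| Forbid_bull : forbidden bull
| Forbid_gem : forbidden gem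
| Forbid_wheel4 : forbidden wheel4
| Forbid_kite : forbidden kite
| Forbid_X1 : forbidden X1
| Forbid_X2 : forbidden X2
| Forbid_K4_plus_l : forbidden K4_plus_l
| Forbid_K5_minus_e : forbidden K5_minus_e
| Forbid_K6 : forbidden (complete_graph 6).

(* Main.v *)
Require Import Defs.
From mathcomp Require Import all_boot.
From mathcomp Require Import zify.

Set Implicit Arguments.
Unset Strict Implicit.
Unset Printing Implicit Defensive.

(* In a colouring as in (1), two edges of the same colour at a vertex span a
   triangle whose third edge has the other colour. Every forbidden graph is seen
   not to have such a colouring, while K5 (two edge-disjoint 5-cycles), the
   diamond, the even cycles and the butterflies have one; this gives
   (2) => (1) => (3).

   For (3) => (2), let G be connected and free. A K4 makes G complete and a
   diamond makes G a diamond, because any further adjacent vertex creates a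
   forbidden graph. Otherwise every edge is in at most one triangle and every
   triangle has at most one vertex with neighbours outside it. If G is not
   complete, let p_0, ..., p_k be a longest induced path, k >= 2. A vertex off the
   path with a neighbour on it is adjacent to exactly {p_0, p_1}, {p_(k-1), p_k} or
   {p_0, p_k}. In the third case G is a cycle, of even length; otherwise there is
   at most one vertex of each of the first two kinds and nothing else, so G is
   induced in a butterfly. *)

(** * Induced subgraphs as embeddings, and colourings as relations *)

Definition embeds (H G : sgraph) : Prop :=
  exists2 g : H -> G, injective g & forall x y, sedge (g x) (g y) = sedge x y.

(** Trades a vertex set with an isomorphism for an injective map out of the pattern, which can be
    given by listing vertices. One direction inverts the isomorphism; the other takes the image of
    [g]. *)
Lemma cg_inducedP (G H : cgraph) :
  (exists S : {set G}, cg_iso (cg_induced S) H) <->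
  exists2 g : H -> G, injective g &
    forall x y, sedge (g x) (g y) = sedge x y /\
      (sedge x y -> cg_colour [set g x; g y] = cg_colour [set x; y]).
Proof.
split=> [[S [f [bij_f fE fC]]]|[g g_inj gE]].
  have [h fK hK] := bij_f.
  exists (fun x => val (h x)) => [|x y]; first exact: inj_comp val_inj (can_inj hK).
  have E : sedge (val (h x)) (val (h y)) = sedge x y by have := fE (h x) (h y); rewrite !hK.
  split=> // xy; have := fC (h x) (h y); rewrite !hK => -> //=.
    by rewrite imsetU1 imset_set1.
  by rewrite /induced_rel /= E.
pose S := [set g x | x in H].
have gS x : g x \in S by apply: imset_f.
pose h x : induced S := exist _ (g x) (gS x).
have [||f hK fK] := @inj_card_bij _ _ h.
- by move=> x y /(congr1 val) /g_inj.
- by rewrite card_sig (eq_card (B := S)) // card_imset.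
exists S, f; split=> [|u v|u v]; first by exists h.
  by rewrite -{2}(fK u) -{2}(fK v) -(gE (f u) (f v)).1.
rewrite -{1}(fK u) -{1}(fK v) => uv.
have fuv : sedge (f u) (f v) by rewrite -(gE _ _).1.
rewrite -((gE _ _).2 fuv) /= imsetU1 imset_set1.
by rewrite -{2}(fK u) -{2}(fK v).
Qed.

Lemma induced_subgraphP (H G : sgraph) : induced_subgraph_of H G <-> embeds H G.
Proof.
(* With constant colourings the colour condition is vacuous. *)
have P := cg_inducedP (monochromatic Red G) (monochromatic Red H).
split=> [[S [f f_bij fE]]|[g g_inj gE]].
  have [|g g_inj gE] := P.1; first by exists S, f.
  by exists g => // x y; have [] := gE x y.
have [|S [f [f_bij fE _]]] := P.2; first by exists g.
by exists S, f.
Qed.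

Lemma embeds_trans (H G K : sgraph) : embeds H G -> embeds G K -> embeds H K.
Proof.
move=> [g g_inj gE] [h h_inj hE]; exists (h \o g); first exact: inj_comp.
by move=> x y; rewrite /= hE gE.
Qed.

Lemma embeds_induced (G : sgraph) (S : {set G}) : embeds (induced S) G.
Proof. by exists val => //; apply: val_inj. Qed.

(** A choice of preimages in [D] is injective because [g] undoes it. The set [D] discards vertices
    of [H] that have no counterpart in [G], such as the tip of a missing triangle of a butterfly. *)
Lemma embeds_section (G H : sgraph) (g : H -> G) (D : pred H) :
  (forall x, exists2 i, D i & g i = x) ->
  {in D &, forall i j, sedge (g i) (g j) = sedge i j} -> embeds G H.
Proof.
move=> g_onto gE; have [f fD fK] := fin_all_exists2 g_onto.
exists f => [|x y]; first exact: can_inj fK.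
by have := gE (f x) (f y) (fD x) (fD y); rewrite !fK.
Qed.

(* k x y tells whether the edge xy is red; off the edges k is irrelevant. The
   second clause excludes the four monochromatic patterns at once. *)
Definition colouring (G : sgraph) (k : rel G) : Prop :=
  (forall x y, sedge x y -> k x y = k y x) /\
  (forall x y z, sedge x y -> sedge y z -> x != z -> k x y = k y z ->
     sedge x z && (k x z != k x y)).

Definition colourable (G : sgraph) : Prop := exists k : rel G, colouring k.

Lemma ord3P (i : 'I_3) : [\/ i = @Ordinal 3 0 isT, i = @Ordinal 3 1 isT | i = @Ordinal 3 2 isT].
Proof.
by case: i => [[|[|[|//]]] lt_m]; [constructor 1|constructor 2|constructor 3]; exact: val_inj.
Qed.

Definition to_bool (k : colour) := if k is Red then true else false.

Lemma to_bool_inj : injective to_bool.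
Proof. by case=> [] []. Qed.

(** Two edges of one colour at a vertex form a monochromatic [P3] if their other ends are not
    adjacent, and a monochromatic triangle if the third edge has the same colour too. *)
Lemma colourableP (G : sgraph) :
  (exists c : {set G} -> colour, cg_free mono_P3_K3 (@CGraph G c)) <-> colourable G.
Proof.
split=> [[c c_free]|[k [k_sym k_good]]].
  exists (fun x y => to_bool (c [set x; y])); split=> [x y _|x y z xy yz xz /to_bool_inj cxy].
    by rewrite setUC.
  have xNy : x != y by apply: contraTneq xy => ->; rewrite sedge_irr.
  have yNz : y != z by apply: contraTneq yz => ->; rewrite sedge_irr.
  pose g (i : 'I_3) := nth x [:: x; y; z] i.
  have g_inj : injective g.
    move=> i j; case/ord3P: (i) => ->; case/ord3P: (j) => -> // /eqP;
      by rewrite /g /= ?(negPf xNy) ?(negPf yNz) ?(negPf xz) // eq_sym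
        ?(negPf xNy) ?(negPf yNz) ?(negPf xz).
  apply: contraT => bad; case xzE: (sedge x z) bad => /= bad.
    have cxz : c [set x; z] = c [set x; y].
      by apply: to_bool_inj; apply/eqP; rewrite negbK in bad.
    have/(_ (monochromatic (c [set x; y]) (complete_graph 3))) := c_free.
    case cE: (c _); move/(_ ltac:(constructor)); case; apply/cg_inducedP;
      exists g => // i j; case/ord3P: (i) => ->; case/ord3P: (j) => ->;
      split; rewrite /g /= ?sedge_irr ?xzE ?(sedge_sym z) ?(sedge_sym y x) ?xzE ?xy ?yz //= => _;
      by rewrite ?(setUC [set z]) ?(setUC [set y] [set x]) ?cxz -?cxy ?cE.
  have/(_ (monochromatic (c [set x; y]) P3)) := c_free.
  case cE: (c _); move/(_ ltac:(constructor)); case; apply/cg_inducedP;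
    exists g => // i j; case/ord3P: (i) => ->; case/ord3P: (j) => ->;
    split; rewrite /g /= ?sedge_irr ?xzE ?(sedge_sym z) ?(sedge_sym y x) ?xzE ?xy ?yz //= => _;
    by rewrite ?(setUC [set z]) ?(setUC [set y] [set x]) -?cxy ?cE.
(* A set is red if some ordered pair that lists it is a red edge; symmetry of [k] on edges makes the
   order irrelevant. *)
pose c (e : {set G}) :=
  if [exists x, exists y, [&& e == [set x; y], sedge x y & k x y]] then Red else Blue.
have cE x y : sedge x y -> to_bool (c [set x; y]) = k x y.
  move=> xy; rewrite /c; case: ifP => [/existsP[u /existsP[v /and3P[/eqP E uv kuv]]]|].
    have : x \in [set u; v] by rewrite -E set21.
    have : y \in [set u; v] by rewrite -E set22.
    rewrite !inE => /orP[]/eqP yE /orP[]/eqP xE; move: xy; rewrite xE yE ?sedge_irr //.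
    by move=> vu; rewrite k_sym.
  by move/negbT/existsPn/(_ x)/existsPn/(_ y); rewrite eqxx xy /=; case: (k x y).
exists c => H HF /cg_inducedP[g g_inj gE].
have [P [q [HE qT]]] : exists P q, H = monochromatic q P /\
  (P = P3 \/ P = complete_graph 3) by case: HF; do 2!eexists; split; eauto.
subst H; have kE i j : sedge i j -> k (g i) (g j) = to_bool q.
  by move=> ij; have [eij /(_ ij) cij] := gE i j; rewrite -cE ?eij //; move: cij => /= ->.
have kP x y z : sedge x y -> sedge y z -> x != z -> sedge x z && (k (g x) (g z) != to_bool q).
  move=> xy yz xz; have := k_good (g x) (g y) (g z).
  rewrite !(gE _ _).1 (kE x y) ?(kE y z) // => -> //.
  by apply: contraNneq xz => /g_inj ->.
(* Both patterns contain the path 0, 1, 2. In [P3] its ends are not adjacent; in the triangle the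
   third edge has the same colour. *)
case: qT => PE; subst P;
  have /(_ isT isT isT)/andP[//] := kP (@Ordinal 3 0 isT) (@Ordinal 3 1 isT) (@Ordinal 3 2 isT).
by rewrite kE ?eqxx.
Qed.

Lemma colourable_embeds (H G : sgraph) : embeds H G -> colourable G -> colourable H.
Proof.
move=> [g g_inj gE] [k [k_sym k_good]].
exists (fun x y => k (g x) (g y)); split=> [x y xy|x y z xy yz xz].
  by rewrite k_sym ?gE.
by rewrite -(gE x z); apply: k_good; rewrite ?gE // (inj_eq g_inj).
Qed.

(** * The forbidden graphs have no colouring *)

Lemma sedge_ordE (n : nat) (r : rel 'I_n) (i j : 'I_n) :
  @sedge (simple_graph r) i j = ((i : nat) != j) && (r i j || r j i).
Proof. by []. Qed.

Definition edge_in (es : seq (nat * nat)) (i j : nat) : bool :=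
  (i != j) && (((i, j) \in es) || ((j, i) \in es)).

Fixpoint bitseqs (m : nat) : seq bitseq :=
  if m is m'.+1 then map (cons true) (bitseqs m') ++ map (cons false) (bitseqs m')
  else [:: [::]].

Lemma mem_bitseqs (b : bitseq) : b \in bitseqs (size b).
Proof. by elim: b => //= c b IHb; rewrite mem_cat; case: c; rewrite map_f ?orbT. Qed.

(* The index of the edge ij in es, in either orientation; size es if ij is not
   an edge. *)
Definition edge_index (es : seq (nat * nat)) (i j : nat) : nat :=
  if (i, j) \in es then index (i, j) es else index (j, i) es.

(* Each path i j l yields the positions of its two edges, and whether and where
   the edge il occurs. *)
Definition constraints (n : nat) (es : seq (nat * nat)) : seq (nat * nat * (bool * nat)) :=
  [seq (edge_index es t.1.1 t.1.2, edge_index es t.1.2 t.2,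
        (edge_in es t.1.1 t.2, edge_index es t.1.1 t.2))
     | t <- [seq (u, l) | u <- [seq (i, j) | i <- iota 0 n, j <- iota 0 n], l <- iota 0 n]
     & [&& edge_in es t.1.1 t.1.2, edge_in es t.1.2 t.2 & t.1.1 != t.2]].

Definition violated (b : bitseq) (c : nat * nat * (bool * nat)) : bool :=
  (nth false b c.1.1 == nth false b c.1.2) &&
  ~~ (c.2.1 && (nth false b c.2.2 != nth false b c.1.1)).

(** Exhaustive search by computation: a colouring is a bit sequence with one bit per edge of [es].
    The [let] computes the constraints once for all sequences. *)
Lemma violated_uncolourable (n : nat) (es : seq (nat * nat)) :
  all (fun e => (e.1 < n.+1) && (e.2 < n.+1)) es ->
  (let cs := constraints n.+1 es in all (fun b => has (violated b) cs) (bitseqs (size es))) ->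
  ~ colourable (graph_on n.+1 es).
Proof.
move=> /allP es_lt /allP bad [k [k_sym k_good]].
pose v i : graph_on n.+1 es := inord i.
have vE i j : i < n.+1 -> j < n.+1 -> sedge (v i) (v j) = edge_in es i j.
  by move=> lti ltj; rewrite sedge_ordE /edge_in !inordK.
pose b := [seq k (v e.1) (v e.2) | e <- es].
have bE i j : i < n.+1 -> j < n.+1 -> edge_in es i j ->
    nth false b (edge_index es i j) = k (v i) (v j).
  move=> lti ltj ij; have nthb x y : (x, y) \in es ->
      nth false b (index (x, y) es) = k (v x) (v y).
    by move=> xy; rewrite (nth_map (x, y)) ?index_mem // nth_index.
  rewrite /edge_index; case: ifP => [/nthb //|Nij].
  rewrite nthb; last by move: ij; rewrite /edge_in Nij => /andP[].
  by rewrite k_sym // sedge_sym vE.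
have sz_b : size b = size es by rewrite size_map.
have := bad b; rewrite -sz_b => /(_ (mem_bitseqs b)) /hasP[c /mapP[[[i j] l]]].
rewrite mem_filter => /andP[/and3P[/= ij jl il] _ ->].
have lt_es x y : edge_in es x y -> (x < n.+1) && (y < n.+1).
  by move=> /andP[_ /orP[] /es_lt]; rewrite // andbC.
have /andP[lti ltj] := lt_es _ _ ij; have /andP[_ ltl] := lt_es _ _ jl.
rewrite /violated /= (bE i j) // (bE j l) // => /andP[/eqP kE /negP[]].
have /andP[il' kil] : sedge (v i) (v l) && (k (v i) (v l) != k (v i) (v j)).
  apply: (k_good _ (v j)); rewrite ?vE //.
  by apply: contraNneq il => /(congr1 val); rewrite /= !inordK // => ->.
by rewrite vE // in il'; rewrite il' bE.
Qed.

(** The largest search is for [K5_minus_e]: 9 edges, hence 512 bit sequences. *)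
Lemma forbidden_small_uncolourable :
  [/\ ~ colourable claw, ~ colourable house, ~ colourable bull, ~ colourable gem
    & ~ colourable wheel4] /\
  [/\ ~ colourable kite, ~ colourable X1, ~ colourable X2, ~ colourable K4_plus_l
    & ~ colourable K5_minus_e].
Proof. by split; split; apply: violated_uncolourable; vm_compute. Qed.

(** Three edges of one colour at [v] force all edges among [a], [b], [c] to exist in the other
    colour, which makes that triangle monochromatic. *)
Lemma star_uncolourable (G : sgraph) (k : rel G) (v a b c : G) : colouring k ->
  sedge v a -> sedge v b -> sedge v c -> a != b -> b != c -> a != c ->
  k v a = k v b -> k v b = k v c -> False.
Proof.
move=> [k_sym k_good] va vb vc ab bc ac kab kbc.
have N x y : sedge v x -> sedge v y -> x != y -> k v x = k v y ->
    sedge x y /\ k x y = ~~ k v x.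
  move=> vx vy xy kxy; have := k_good x v y.
  rewrite sedge_sym vx vy (k_sym x v) 1?sedge_sym // => /(_ isT isT xy kxy) /andP[-> neq].
  by split=> //; move: neq; case: (k x y); case: (k v x).
have [eab cab] := N _ _ va vb ab kab; have [ebc cbc] := N _ _ vb vc bc kbc.
have [eac cac] := N _ _ va vc ac (etrans kab kbc).
by have := k_good a b c eab ebc ac; rewrite cab cbc cac kab eqxx andbF => /(_ erefl).
Qed.

(** By pigeonhole, three of the five edges at a vertex share a colour; [mono] is applied to the ten
    possible triples. *)
Lemma complete6_uncolourable : ~ colourable (complete_graph 6).
Proof.
move=> [k kP]; pose o i : complete_graph 6 := inord i.
have oE i j : i < 6 -> j < 6 -> i != j -> sedge (o i) (o j) /\ o i != o j.
  move=> lti ltj ij; have neq : o i != o j.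
    by apply: contraNneq ij => /(congr1 val); rewrite /= !inordK // => ->.
  by split=> //; apply/andP; split; [|apply/orP; left]; exact: neq.
have mono a b c : 0 < a < b -> b < c < 6 -> k (o 0) (o a) = k (o 0) (o b) ->
    k (o 0) (o b) = k (o 0) (o c) -> False.
  by move=> ab bc; apply: (star_uncolourable kP); apply oE; lia.
have := (mono 1 2 3, mono 1 2 4, mono 1 2 5, mono 1 3 4, mono 1 3 5, mono 1 4 5,
  mono 2 3 4, mono 2 3 5, mono 2 4 5, mono 3 4 5) => {mono}.
case: (k (o 0) (o 1)); case: (k (o 0) (o 2)); case: (k (o 0) (o 3));
  case: (k (o 0) (o 4)); case: (k (o 0) (o 5)) => -[[[[[[[[[h0 h1] h2] h3] h4] h5] h6] h7] h8] h9];
  first [exact: (h0 isT isT) | exact: (h1 isT isT) | exact: (h2 isT isT) | exact: (h3 isT isT)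
    | exact: (h4 isT isT) | exact: (h5 isT isT) | exact: (h6 isT isT) | exact: (h7 isT isT)
    | exact: (h8 isT isT) | exact: (h9 isT isT)].
Qed.

Lemma modnS_ord (n i : nat) : i < n -> i.+1 %% n = if i.+1 == n then 0 else i.+1.
Proof. by move=> lti; case: eqP => [->|ne]; rewrite ?modnn // modn_small //; lia. Qed.

(** Vertices at distance 2 on the cycle are not adjacent, so consecutive edges alternate in colour,
    which is impossible around an odd cycle. *)
Lemma odd_cycle_uncolourable (n : nat) : odd n -> 5 <= n -> ~ colourable (cycle_graph n).
Proof.
move=> n_odd n_ge5 [k [k_sym k_good]].
have n_gt0 : 0 < n by lia.
(* Indexing by all natural numbers modulo [n] lets the induction go once around, to [a n = a 0]. *)
pose q i : cycle_graph n := Ordinal (ltn_pmod i n_gt0).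
have qS i : sedge (q i) (q i.+1) /\ sedge (q i) (q i.+2) = false /\ q i != q i.+2.
  have lti := ltn_pmod i n_gt0.
  have E1 : i.+1 %% n = (i %% n).+1 %% n by rewrite -addn1 -modnDml addn1.
  have E2 : i.+2 %% n = (i.+1 %% n).+1 %% n by rewrite -addn1 -modnDml addn1.
  have -> : (q i != q i.+2) = (i %% n != i.+2 %% n) by [].
  rewrite !sedge_ordE /= E2 E1.
  move: (i %% n) lti => m ltm; clear -ltm n_ge5.
  rewrite (@modnS_ord n m) //; case: ifP => /eqP Em; rewrite modnS_ord; try lia;
    case: ifP => /eqP Em1; rewrite ?modnS_ord; try lia; case: ifP => /eqP; lia.
pose a i := k (q i) (q i.+1).
have aS i : a i.+1 = ~~ a i.
  have [q1 [q2 q3]] := qS i; have [q1' _] := qS i.+1.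
  have := k_good _ _ _ q1 q1' q3; rewrite q2 /= -/(a i) -/(a i.+1).
  by case: (a i) (a i.+1) => [] [] // /(_ erefl).
have aE i : a i = odd i (+) a 0 by elim: i => // i IHi; rewrite aS IHi /= addNb.
have : a n = a 0.
  by rewrite /a; congr k; apply: val_inj => /=; rewrite ?modnn ?mod0n // -addn1 modnDl.
by rewrite aE n_odd; case: (a 0).
Qed.

Lemma forbidden_uncolourable (H : sgraph) : forbidden H -> ~ colourable H.
Proof.
have [[? ? ? ? ?] [? ? ? ? ?]] := forbidden_small_uncolourable.
by case=> // [n|]; [apply: odd_cycle_uncolourable | apply: complete6_uncolourable].
Qed.

Lemma colourable_free (G : sgraph) : colourable G -> free forbidden G.
Proof.
move=> colG H /forbidden_uncolourable colH /induced_subgraphP HG.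
exact: colH (colourable_embeds HG colG).
Qed.

(** * Colouring the components *)

Lemma complete5_colourable : colourable (complete_graph 5).
Proof.
(* Red is the pentagon and blue the pentagram. *)
exists (fun i j : 'I_5 => (j == i.+1 %% 5 :> nat) || (i == j.+1 %% 5 :> nat)).
split=> [i j _|i j l]; first by rewrite orbC.
by case: i j l => [[|[|[|[|[|//]]]]] ?] [[|[|[|[|[|//]]]]] ?] [[|[|[|[|[|//]]]]] ?].
Qed.

Lemma diamond_colourable : colourable diamond.
Proof.
(* Red is the path 3, 0, 1, 2 and blue the matching 02, 13. *)
exists (fun i j : 'I_4 => odd (i + j)); split=> [i j _|i j l]; first by rewrite addnC.
by case: i j l => [[|[|[|[|//]]]] ?] [[|[|[|[|//]]]] ?] [[|[|[|[|//]]]] ?].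
Qed.

Lemma even_cycle_colourable (m : nat) : 2 <= m -> colourable (cycle_graph (2 * m)).
Proof.
(* Edge [i], [i.+1] is red when [i] is odd. The first disjunct turns the closing edge from 0 to
   [2 * m - 1] red; both its neighbours on the cycle are blue. *)
move=> m_ge2; pose k (i j : nat) := ((minn i j == 0) && (1 < maxn i j)) || odd (minn i j).
have kC i j : k i j = k j i by rewrite /k minnC maxnC.
pose e (c : bool) (i j : nat) := (j = i.+1 /\ c = odd i) \/ (i.+1 = 2 * m /\ j = 0 /\ c).
have eP i j : i < 2 * m -> j == i.+1 %% (2 * m) -> e (k i j) i j.
  move=> lti; rewrite modnS_ord // /e /k; clear -lti m_ge2.
  by case: ifP => /eqP ? /eqP ->; [right; split; [|split] | left; split]; lia.
exists (fun i j : 'I_(2 * m) => k i j); split=> [i j _|i j l]; first exact: kC.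
rewrite !sedge_ordE; have -> : (i != l) = (i != l :> nat) by [].
case: i j l => [i lti] [j ltj] [l ltl] /= /andP[_ ij] /andP[_ jl] il kE; exfalso.
have {ij} : e (k i j) i j \/ e (k i j) j i.
  by case/orP: ij => /eP; [left | right; rewrite kC]; auto.
have {jl} : e (k j l) j l \/ e (k j l) l j.
  by case/orP: jl => /eP; [left | right; rewrite kC]; auto.
rewrite -{}kE; move: (k i j) => c; rewrite /e; clear -il m_ge2 lti ltj ltl.
by move=> [[[E1 E2]|[E1 [E2 E3]]]|[[E1 E2]|[E1 [E2 E3]]]];
  move=> [[[F1 F2]|[F1 [F2 F3]]]|[[F1 F2]|[F1 [F2 F3]]]]; lia.
Qed.

Lemma butterfly_colourable (n : nat) : colourable (butterfly n).
Proof.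
(* Colours alternate along 0, 1, 2, and so on. The exception for 02 makes both triangle edges at 2
   red, against 01 and 23 in blue; at [n + 2] the parity of the minimum already gives both edges of
   the far triangle one colour and its third edge the other. *)
pose k (i j : nat) := ((i + j == 2) && (i != j)) || odd (minn i j).
have kC i j : k i j = k j i by rewrite /k addnC minnC (eq_sym i).
pose r (i j : nat) :=
  [|| j == i.+1, (i == 0) && (j == 2) | (i == n + 2) && (j == n + 4)].
pose e (c : bool) (i j : nat) :=
  (j = i.+1 /\ c = odd i) \/ (i = 0 /\ j = 2 /\ c) \/
  (i = n.+2 /\ j = n.+4 /\ c = odd n).
have rP i j : r i j -> e (k i j) i j.
  rewrite /r /k /e => /or3P[/eqP->|/andP[/eqP-> /eqP->]|/andP[/eqP-> /eqP->]].
  - by left; split=> //; clear; lia.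
  - by right; left.
  - by right; right; clear; split; [|split]; lia.
have eP c i j : e c i j -> [/\ i != j, r i j & k i j = c].
  rewrite /e /r /k => -[[-> ->]|[[-> [-> ->]]|[-> [-> ->]]]].
  - by clear; split; lia.
  - by [].
  - by clear; split; lia.
exists (fun i j : 'I_(n + 5) => k i j); split=> [i j _|i j l]; first exact: kC.
rewrite !sedge_ordE -/(r i j) -/(r j i) -/(r j l) -/(r l j) -/(r i l) -/(r l i).
have -> : (i != l) = (i != l :> nat) by [].
case: i j l => [i lti] [j ltj] [l ltl] /=.
move=> /andP[_ ij] /andP[_ jl] il; have {ij} : e (k i j) i j \/ e (k i j) j i.
  by case/orP: ij => /rP; [left | right; rewrite kC].
have {jl} : e (k j l) j l \/ e (k j l) l j.
  by case/orP: jl => /rP; [left | right; rewrite kC].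
move=> + + ck; rewrite -{}ck; set c := k i j => jl ij.
(* The third edge must exist in the colour opposite to [c]; [e c i j] says that [i], [j] is listed
   in this direction with colour [c]. *)
suff [/eP[-> -> ->]|/eP[li rli kli]] : e (~~ c) i l \/ e (~~ c) l i.
- by case: (c).
- by rewrite eq_sym li rli orbT kC kli; case: (c).
move: c ij jl => c; rewrite /e; clear -il lti ltj ltl.
move=> [[[E1 E2]|[[E1 [E2 E3]]|[E1 [E2 E3]]]]|[[E1 E2]|[[E1 [E2 E3]]|[E1 [E2 E3]]]]];
move=> [[[F1 F2]|[[F1 [F2 F3]]|[F1 [F2 F3]]]]|[[F1 F2]|[[F1 [F2 F3]]|[F1 [F2 F3]]]]].
all: first
  [ exfalso; lia | left; left; lia | left; right; left; lia | left; right; right; lia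
  | right; left; lia | right; right; left; lia | right; right; right; lia].
Qed.

Section Components.
Variable G : sgraph.

Let connect_equivalence : {in [set: G] & &, equivalence_rel (connect (@sedge G))}.
Proof.
move=> x y z _ _ _; split=> [|xy]; first exact: connect0.
exact/same_connect/xy/sym_connect_sym/sedge_sym.
Qed.

Lemma mem_component (C : {set G}) (x y : G) :
  C \in components G -> x \in C -> (y \in C) = connect (@sedge G) x y.
Proof.
move=> CG Cx; have /and3P[_ triv _] := equivalence_partitionP connect_equivalence.
by rewrite -(def_pblock triv CG Cx) pblock_equivalence_partition ?inE.
Qed.

Lemma mem_own_component (x : G) :
  x \in pblock (components G) x /\ pblock (components G) x \in components G.
Proof.
have /and3P[/eqP cov _ _] := equivalence_partitionP connect_equivalence.
by rewrite mem_pblock pblock_mem /components cov ?inE.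
Qed.

(** The condition on a colouring only concerns paths of two edges, which stay in one component, so
    colourings of the components glue. *)
Lemma components_colourable :
  (forall C : {set G}, C \in components G -> colourable (induced C)) -> colourable G.
Proof.
(* Each colouring is first extended to a relation on all of [G], so that the chosen relations have a
   type independent of [C]. *)
move=> colC; have /fin_all_exists[kc kcP] : forall C : {set G}, exists k : rel G,
    C \in components G -> colouring (fun x y : induced C => k (val x) (val y)).
  move=> C; case: (boolP (C \in components G)) => [/colC[k kP]|_]; last by exists (fun _ _ => true).
  exists (fun x y => [exists u : induced C, exists v : induced C,
    [&& val u == x, val v == y & k u v]]).
  move=> _; have kE (u v : induced C) : [exists u' : induced C, exists v' : induced C,
      [&& val u' == val u, val v' == val v & k u' v']] = k u v.
    apply/existsP/idP => [[u' /existsP[v' /and3P[/eqP/val_inj-> /eqP/val_inj->]]]//|kuv].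
    by exists u; apply/existsP; exists v; rewrite !eqxx.
  case: kP => k_sym k_good; split=> [u v|u v w]; rewrite !kE; [exact: k_sym | exact: k_good].
pose C x := pblock (components G) x.
have CE x y : sedge x y -> y \in C x.
  by move=> xy; have [? ?] := mem_own_component x; rewrite (mem_component (x := x)) // connect1.
have CC x y : y \in C x -> C y = C x.
  have /and3P[_ triv _] := equivalence_partitionP connect_equivalence.
  by move=> Cxy; apply: same_pblock.
exists (fun x y => kc (C x) x y); split=> [x y xy|x y z xy yz xz].
  have [Cx CG] := mem_own_component x; have [k_sym _] := kcP _ CG.
  rewrite (CC x y) ?CE //.
  exact: (k_sym (exist _ x Cx) (exist _ y (CE _ _ xy))).
have [Cx CG] := mem_own_component x; have [_ k_good] := kcP _ CG.
have Cy := CE _ _ xy; have := CE _ _ yz; rewrite (CC x y) // => Cz.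
by apply: (k_good (exist _ x Cx) (exist _ y Cy) (exist _ z Cz)).
Qed.

(** The set [A] of vertices reached from [x] inside [C] is closed under adjacency in [G], so it
    contains the whole component. *)
Lemma component_connected (C : {set G}) : C \in components G ->
  forall x y : induced C, connect (@sedge (induced C)) x y.
Proof.
move=> CG x y; pose A := [set val z | z in connect (@sedge (induced C)) x].
have Ax : val x \in A by apply: imset_f; rewrite inE connect0.
have closedA : closed (@sedge G) (mem A).
  apply: intro_closed => [|u v uv /imsetP[z xz uE]]; first exact/sym_connect_sym/sedge_sym.
  have Cv : v \in C.
    by rewrite (mem_component _ CG (valP z)) connect1 // -uE.
  apply/imsetP; exists (exist _ v Cv) => //.
  by apply: connect_trans xz _; apply: connect1; rewrite /= /induced_rel /= -uE.
have : val y \in A.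
  rewrite -(closed_connect closedA (x := val x)) //.
  by rewrite -(mem_component _ CG (valP x)) (valP y).
by case/imsetP => z xz /val_inj ->.
Qed.

End Components.

Lemma components_embed_colourable (G : sgraph) :
  (forall C : {set G}, C \in components G ->
     [\/ induced_subgraph_of (induced C) (complete_graph 5),
         induced_subgraph_of (induced C) diamond,
         exists2 m : nat, 2 <= m & induced_subgraph_of (induced C) (cycle_graph (2 * m))
       | exists n : nat, induced_subgraph_of (induced C) (butterfly n)]) ->
  colourable G.
Proof.
move=> shape; apply: components_colourable => C /shape.
case=> [|| [m m_ge2] | [n]] /induced_subgraphP emb; apply: colourable_embeds emb _.
- exact: complete5_colourable.
- exact: diamond_colourable.
- exact: even_cycle_colourable.
- exact: butterfly_colourable.
Qed.

(** * Connected graphs without forbidden subgraphs *)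

Section Structure.
Variable G : sgraph.
Hypothesis G_free : free forbidden G.
Hypothesis G_connected : forall x y : G, connect (@sedge G) x y.

Let sedgeN (x y : G) : sedge x y -> x != y.
Proof. by apply: contraTneq => ->; rewrite sedge_irr. Qed.

Let sedge2 (x y : G) (b : bool) : sedge x y = b -> (sedge x y = b) * (sedge y x = b).
Proof. by move=> <-; rewrite [sedge y x]sedge_sym. Qed.

Lemma connected_ind (P : pred G) (x : G) :
  P x -> (forall y z, P y -> sedge y z -> P z) -> forall y, P y.
Proof.
move=> Px PS y; have /connectP[p + ->] := G_connected x y.
elim: p x Px => //= z p IHp x Px /andP[xz zp]; exact: IHp (PS _ _ Px xz) zp.
Qed.

(** The listed vertices play the vertices 0, 1, ... of the pattern in this order. Checking pairs
    [j < i] is enough, by symmetry and irreflexivity. *)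
Lemma no_pattern (es : seq (nat * nat)) (x : G) (s : seq G) :
  forbidden (graph_on (size s).+1 es) -> uniq (x :: s) ->
  all (fun i => all (fun j => sedge (nth x (x :: s) j) (nth x (x :: s) i) == edge_in es j i)
    (iota 0 i)) (iota 0 (size s).+1) -> False.
Proof.
move=> forb uniq_s /allP match_s; apply: (G_free forb); apply/induced_subgraphP.
pose g (i : 'I_(size s).+1) := nth x (x :: s) i.
have gE (i j : 'I_(size s).+1) : i < j -> sedge (g i) (g j) = edge_in es i j.
  move=> ij; have /allP/(_ (val i)) := match_s (val j) ltac:(by rewrite mem_iota /=).
  by rewrite mem_iota /= => /(_ ij) /eqP.
exists g => [i j /eqP|i j]; first by rewrite nth_uniq // => /eqP/val_inj.
rewrite sedge_ordE; case: (ltngtP i j) => [ij|ji|/val_inj->]; last by rewrite sedge_irr.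
  by rewrite gE // /edge_in ltn_eqF.
by rewrite sedge_sym gE // /edge_in ltn_eqF // orbC.
Qed.

(** * Claws, diamonds and [K4] *)

Lemma claw_free (v a b c : G) : sedge v a -> sedge v b -> sedge v c ->
  a != b -> b != c -> a != c -> [|| sedge a b, sedge a c | sedge b c].
Proof.
move=> va vb vc ab bc ac; apply: contraT; rewrite !negb_or.
move=> /and3P[/negPf nab /negPf nac /negPf nbc].
case: (@no_pattern _ v [:: a; b; c] Forbid_claw).
  by rewrite /= !inE !negb_or (sedgeN va) (sedgeN vb) (sedgeN vc) ab ac bc.
by rewrite /= va vb vc nab nac nbc.
Qed.

(** Every nonempty neighbourhood of [x] in the diamond gives a forbidden graph: four neighbours give
    [K5_minus_e]; three give [X2] or [wheel4]; two give [claw], [gem] or [X1]; one gives [claw] or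
    [kite]. *)
Lemma diamond_closed (a b c d x : G) :
  sedge a b -> sedge a c -> sedge a d -> sedge b c -> sedge b d -> ~~ sedge c d -> c != d ->
  x \notin [:: a; b; c; d] -> ~~ [|| sedge x a, sedge x b, sedge x c | sedge x d].
Proof.
move=> ab ac ad bc bd /negPf cd cNd; rewrite !inE !negb_or => /and4P[xa xb xc xd].
have neq := (sedgeN ab, sedgeN ac, sedgeN ad, sedgeN bc, sedgeN bd, cNd, xa, xb, xc, xd).
have neqs := (neq, (eq_sym b a, eq_sym c a, eq_sym d a, eq_sym c b, eq_sym d b, eq_sym d c,
  eq_sym a x, eq_sym b x, eq_sym c x, eq_sym d x)).
have E := (sedge2 ab, sedge2 ac, sedge2 ad, sedge2 bc, sedge2 bd, sedge2 cd).
case Exa: (sedge x a); case Exb: (sedge x b); case Exc: (sedge x c); case Exd: (sedge x d) => //;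
  have E' := (E, sedge2 Exa, sedge2 Exb, sedge2 Exc, sedge2 Exd); exfalso.
- by case: (@no_pattern _ a [:: b; x; c; d] Forbid_K5_minus_e); rewrite /= ?inE ?negb_or ?neqs ?E'.
- by case: (@no_pattern _ a [:: b; c; d; x] Forbid_X2); rewrite /= ?inE ?negb_or ?neqs ?E'.
- by case: (@no_pattern _ a [:: b; d; c; x] Forbid_X2); rewrite /= ?inE ?negb_or ?neqs ?E'.
- by case: (@no_pattern _ a [:: c; d; x] Forbid_claw); rewrite /= ?inE ?negb_or ?neqs ?E'.
- by case: (@no_pattern _ b [:: c; x; d; a] Forbid_wheel4); rewrite /= ?inE ?negb_or ?neqs ?E'.
- by case: (@no_pattern _ d [:: b; c; x; a] Forbid_gem); rewrite /= ?inE ?negb_or ?neqs ?E'.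
- by case: (@no_pattern _ c [:: b; d; x; a] Forbid_gem); rewrite /= ?inE ?negb_or ?neqs ?E'.
- by case: (@no_pattern _ a [:: c; d; x] Forbid_claw); rewrite /= ?inE ?negb_or ?neqs ?E'.
- by case: (@no_pattern _ a [:: c; x; d; b] Forbid_wheel4); rewrite /= ?inE ?negb_or ?neqs ?E'.
- by case: (@no_pattern _ d [:: a; c; x; b] Forbid_gem); rewrite /= ?inE ?negb_or ?neqs ?E'.
- by case: (@no_pattern _ c [:: a; d; x; b] Forbid_gem); rewrite /= ?inE ?negb_or ?neqs ?E'.
- by case: (@no_pattern _ b [:: c; d; x] Forbid_claw); rewrite /= ?inE ?negb_or ?neqs ?E'.
- by case: (@no_pattern _ a [:: b; c; d; x] Forbid_X1); rewrite /= ?inE ?negb_or ?neqs ?E'.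
- by case: (@no_pattern _ a [:: b; c; d; x] Forbid_kite); rewrite /= ?inE ?negb_or ?neqs ?E'.
- by case: (@no_pattern _ a [:: b; d; c; x] Forbid_kite); rewrite /= ?inE ?negb_or ?neqs ?E'.
Qed.

(** If [x] misses [b], then its adjacency to [c] and [d] gives [K5_minus_e] (both), [X2] (one) or
    [K4_plus_l] (none). *)
Lemma K4_closed (a b c d x : G) :
  sedge a b -> sedge a c -> sedge a d -> sedge b c -> sedge b d -> sedge c d ->
  sedge x a -> x != b -> sedge x b.
Proof.
move=> ab ac ad bc bd cd xa xb; apply: contraT => /negPf Exb.
case: (eqVneq x c) Exb => [->|xc]; first by rewrite sedge_sym bc.
case: (eqVneq x d) => [->|xd Exb]; first by rewrite sedge_sym bd.
have neq := (sedgeN ab, sedgeN ac, sedgeN ad, sedgeN bc, sedgeN bd, sedgeN cd,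
  sedgeN xa, xb, xc, xd).
have neqs := (neq, (eq_sym b a, eq_sym c a, eq_sym d a, eq_sym c b, eq_sym d b, eq_sym d c,
  eq_sym a x, eq_sym b x, eq_sym c x, eq_sym d x)).
have E := (sedge2 ab, sedge2 ac, sedge2 ad, sedge2 bc, sedge2 bd, sedge2 cd, sedge2 xa, sedge2 Exb).
case Exc: (sedge x c); case Exd: (sedge x d) => //;
  have E' := (E, sedge2 Exc, sedge2 Exd); exfalso.
- by case: (@no_pattern _ a [:: c; d; b; x] Forbid_K5_minus_e); rewrite /= ?inE ?negb_or ?neqs ?E'.
- by case: (@no_pattern _ a [:: c; b; x; d] Forbid_X2); rewrite /= ?inE ?negb_or ?neqs ?E'.
- by case: (@no_pattern _ a [:: d; b; x; c] Forbid_X2); rewrite /= ?inE ?negb_or ?neqs ?E'.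
- by case: (@no_pattern _ a [:: b; c; d; x] Forbid_K4_plus_l); rewrite /= ?inE ?negb_or ?neqs ?E'.
Qed.

Lemma clique_embeds : (forall x y : G, x != y -> sedge x y) -> embeds G (complete_graph 5).
Proof.
move=> cliqueG; have card_le5 : #|G| <= 5.
  rewrite leqNgt; apply/negP => card_gt5; apply: (G_free Forbid_K6); apply/induced_subgraphP.
  have /card_gt0P[x0 _] : 0 < #|G| by lia.
  pose g (i : 'I_6) := nth x0 (enum G) i.
  have g_inj : injective g.
    move=> i j /eqP; rewrite nth_uniq -?cardE ?enum_uniq ?(leq_trans (ltn_ord _)) //.
    by move/eqP/val_inj.
  exists g => // i j; case: (eqVneq i j) => [->|ij]; first by rewrite !sedge_irr.
  rewrite cliqueG; last by apply: contraNneq ij => /g_inj ->.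
  by apply/esym/andP; split; [|apply/orP; left]; exact: ij.
pose f (x : G) : 'I_5 := widen_ord card_le5 (enum_rank x).
have f_inj : injective f by move=> x y /(congr1 val) /= /val_inj /enum_rank_inj.
exists f => // x y; case: (eqVneq x y) => [->|xy]; first by rewrite !sedge_irr.
have fxy : f x != f y by apply: contraNneq xy => /f_inj ->.
by rewrite cliqueG //; apply/andP; split; [|apply/orP; left]; exact: fxy.
Qed.

(** Lying in a [K4] spreads from an edge to every edge that meets it. Hence every vertex is in a
    [K4], and adjacency to a fixed vertex then spreads along edges by [K4_closed]. *)
Lemma K4_clique (a b c d : G) :
  sedge a b -> sedge a c -> sedge a d -> sedge b c -> sedge b d -> sedge c d ->
  forall x y : G, x != y -> sedge x y.
Proof.
move=> ab ac ad bc bd cd.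
pose inK4 (u v : G) := [exists w, exists z,
  [&& sedge u v, sedge u w, sedge u z, sedge v w, sedge v z & sedge w z]].
have K4I u v w z : sedge u v -> sedge u w -> sedge u z -> sedge v w -> sedge v z ->
    sedge w z -> inK4 u v.
  move=> uv uw uz vw vz wz; apply/existsP; exists w; apply/existsP; exists z.
  by apply/and5P; rewrite vw vz.
have K4_nbr u v x : inK4 u v -> sedge x u -> inK4 u x.
  move=> /existsP[w /existsP[z /and5P[uv uw uz vw /andP[vz wz]]]] xu.
  case: (eqVneq x v) => [->|xv]; first exact: (K4I u v w z).
  have xv' : sedge x v by apply: (K4_closed (a := u) (b := v) (c := w) (d := z)).
  case: (eqVneq x w) => [->|xw].
    by apply: (K4I u w v z) => //; rewrite sedge_sym.
  have xw' : sedge x w.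
    by apply: (K4_closed (a := u) (b := w) (c := v) (d := z)) => //; rewrite sedge_sym.
  by apply: (K4I u x v w) => //; rewrite sedge_sym.
have inK4C u v : inK4 u v -> inK4 v u.
  move=> /existsP[w /existsP[z /and5P[uv uw uz vw /andP[vz wz]]]].
  by apply: (K4I v u w z) => //; rewrite sedge_sym.
have all_K4 u : [exists v, inK4 u v].
  move: u; apply: (connected_ind (x := a)) => [|u v /existsP[w uw] uv].
    by apply/existsP; exists b; apply: (K4I a b c d).
  by apply/existsP; exists u; apply: inK4C; apply: K4_nbr uw _; rewrite sedge_sym.
move=> x y xy; suff : (y == x) || sedge x y by rewrite eq_sym (negPf xy).
move: y {xy}; apply: (connected_ind (x := x)) => [|y z]; first by rewrite eqxx.
case/orP=> [/eqP->->|xy yz]; first by rewrite orbT.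
case: (eqVneq z x) => //= zx; have /existsP[w yw] := all_K4 y.
have := K4_nbr _ _ _ yw xy; move=> /existsP[u /existsP[v /and5P[yx yu yv xu /andP[xv uv]]]].
by rewrite sedge_sym; apply: (K4_closed (a := y) (b := x) (c := u) (d := v));
  rewrite // sedge_sym.
Qed.

Lemma diamond_embeds (a b c d : G) :
  sedge a b -> sedge a c -> sedge a d -> sedge b c -> sedge b d -> ~~ sedge c d -> c != d ->
  embeds G diamond.
Proof.
move=> ab ac ad bc bd cd cNd; pose g (i : 'I_4) := nth a [:: a; b; c; d] i.
apply: (@embeds_section G diamond g xpredT) => [x|i j _ _]; last first.
  have E := (sedge2 ab, sedge2 ac, sedge2 ad, sedge2 bc, sedge2 bd, sedge2 (negPf cd)).
  by case: i j => [[|[|[|[|//]]]] ?] [[|[|[|[|//]]]] ?]; rewrite /g /= ?sedge_irr ?E.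
have : x \in [:: a; b; c; d].
  move: x; apply: (connected_ind (x := a)) => [|y z yS yz]; first by rewrite mem_head.
  apply: contraTT yz => zS; have := diamond_closed ab ac ad bc bd cd cNd zS.
  rewrite !negb_or => /and4P[za zb zc zd].
  by rewrite sedge_sym; move: yS; rewrite !inE => /or4P[]/eqP->.
rewrite !inE => /or4P[]/eqP->.
- by exists (@Ordinal 4 0 isT).
- by exists (@Ordinal 4 1 isT).
- by exists (@Ordinal 4 2 isT).
- by exists (@Ordinal 4 3 isT).
Qed.

(* Equivalently, G contains neither a diamond nor a K4 as an induced subgraph. *)
Definition edge_in_one_triangle : Prop := forall a b c d : G,
  sedge a b -> sedge a c -> sedge b c -> sedge a d -> sedge b d -> c = d.

Lemma dense_or_one_triangle :
  [\/ embeds G (complete_graph 5), embeds G diamond | edge_in_one_triangle].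
Proof.
case: (boolP [exists a : G, exists b : G, exists c : G, exists d : G,
  [&& sedge a b, sedge a c, sedge b c, sedge a d, sedge b d & c != d]]) => [|none].
  move=> /existsP[a /existsP[b /existsP[c /existsP[d /and5P[ab ac bc ad /andP[bd cNd]]]]]].
  case: (boolP (sedge c d)) => cd; [constructor 1|constructor 2].
    by apply: clique_embeds; apply: (@K4_clique a b c d).
  exact: (@diamond_embeds a b c d).
constructor 3 => a b c d ab ac bc ad bd; apply/eqP; apply: contraNT none => cNd.
by apply/existsP; exists a; apply/existsP; exists b; apply/existsP; exists c; apply/existsP;
  exists d; apply/and5P; rewrite bd.
Qed.

(** * Graphs in which every edge lies in at most one triangle *)

Section OneTriangle.
Hypothesis one_triangle : edge_in_one_triangle.

(** At most one vertex of a triangle has outside neighbours. Since its edges are in no other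
    triangle, [x] sees only [a] and [y] only [b]; a house or a bull results according to whether [x]
    and [y] are adjacent. That [x] and [y] differ is derived, so it need not be checked by
    callers. *)
Lemma triangle_attach (a b c x y : G) :
  sedge a b -> sedge b c -> sedge a c -> sedge x a -> sedge y b ->
  x != b -> x != c -> y != a -> y != c -> False.
Proof.
move=> ab bc ac xa yb xb xc ya yc.
have E := (sedge2 ab, sedge2 bc, sedge2 ac, sedge2 xa, sedge2 yb).
have nxb : sedge x b = false.
  by apply: contraNF xc => xb'; apply/eqP; apply: (one_triangle (a := a) (b := b));
      rewrite ?E ?(sedge2 xb').
have nya : sedge y a = false.
  by apply: contraNF yc => ya'; apply/eqP; apply: (one_triangle (a := a) (b := b));
      rewrite ?E ?(sedge2 ya').
have nxc : sedge x c = false.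
  by apply: contraNF xb => xc'; apply/eqP; apply: (one_triangle (a := a) (b := c));
      rewrite ?E ?(sedge2 xc').
have nyc : sedge y c = false.
  by apply: contraNF ya => yc'; apply/eqP; apply: (one_triangle (a := b) (b := c));
      rewrite ?E ?(sedge2 yc').
have xy : x != y by apply: contraTneq xa => ->; rewrite nya.
have neq := (sedgeN ab, sedgeN ac, sedgeN bc, sedgeN xa, sedgeN yb, (xb, xc, ya, yc, xy)).
have neqs := (neq, (eq_sym b a, eq_sym c a, eq_sym c b), (eq_sym a x, eq_sym b x, eq_sym c x),
  (eq_sym a y, eq_sym b y, eq_sym c y, eq_sym y x)).
have E2 := (E, (sedge2 nxb, sedge2 nxc, sedge2 nya, sedge2 nyc)).
case Exy: (sedge x y); have E' := (E2, sedge2 Exy).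
- by case: (@no_pattern _ a [:: b; y; x; c] Forbid_house); rewrite /= ?inE ?negb_or ?neqs ?E'.
- by case: (@no_pattern _ a [:: b; c; x; y] Forbid_bull); rewrite /= ?inE ?negb_or ?neqs ?E'.
Qed.

(** Here [k] counts edges; values of [p] beyond [k] carry no information. *)
Definition induced_path (k : nat) (p : nat -> G) : Prop := forall i j, i <= k -> j <= k ->
  (p i == p j) = (i == j) /\ sedge (p i) (p j) = (j == i.+1) || (i == j.+1).

Lemma induced_path_rev (k : nat) (p : nat -> G) :
  induced_path k p -> induced_path k (fun i => p (k - i)).
Proof.
move=> pP i j lei lej; have [-> ->] := pP (k - i) (k - j) (leq_subr _ _) (leq_subr _ _).
split; lia.
Qed.

(** The length is bounded by the number of vertices; [E] expresses existence as a boolean, through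
    finite functions, so that a maximum can be taken. *)
Lemma longest_induced_path (k0 : nat) (p0 : nat -> G) : induced_path k0 p0 ->
  exists k p, [/\ k0 <= k, induced_path k p & forall q, ~ induced_path k.+1 q].
Proof.
move=> p0P.
pose E k := [exists f : {ffun 'I_k.+1 -> G}, [forall i : 'I_k.+1, forall j : 'I_k.+1,
  ((f i == f j) == (i == j)) && (sedge (f i) (f j) == (j == i.+1 :> nat) || (i == j.+1 :> nat))]].
have EI k p : induced_path k p -> E k.
  move=> pP; apply/existsP; exists [ffun i : 'I_k.+1 => p i].
  apply/forallP => i; apply/forallP => j; rewrite !ffunE.
  by have [-> ->] := pP i j (ltn_ord i) (ltn_ord j); rewrite !eqxx.
have EE k : E k -> exists p, induced_path k p.
  move=> /existsP[f /forallP fP]; exists (fun i => f (inord i)) => i j lei lej.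
  have /forallP/(_ (inord j))/andP[/eqP-> /eqP->] := fP (inord i).
  by rewrite -val_eqE /= !inordK.
have E_bound k : E k -> k <= #|G|.
  move=> /EE[p pP]; have := max_card (mem [set p i | i : 'I_k.+1]).
  rewrite card_imset ?card_ord; first lia.
  move=> i j /eqP; have [-> _] := pP i j (ltn_ord i) (ltn_ord j).
  by move/eqP/val_inj.
have [k Ek k_max] := ex_maxnP (ex_intro E k0 (EI _ _ p0P)) E_bound.
have [p pP] := EE _ Ek; exists k, p; split=> //; first exact/k_max/(EI _ _ p0P).
by move=> q /EI/k_max; rewrite ltnn.
Qed.

(** * Vertices off a longest induced path *)

Section LongestPath.
Variable k : nat.
Hypothesis k_ge2 : 2 <= k.
Hypothesis k_max : forall q, ~ induced_path k.+1 q.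

Definition off_path (p : nat -> G) (x : G) : bool := x \notin [seq p i | i <- iota 0 k.+1].

Lemma off_pathP (p : nat -> G) (x : G) :
  reflect (forall i, i <= k -> p i != x) (off_path p x).
Proof.
apply: (iffP idP) => [xp i lei|xp].
  by apply: contraNneq xp => <-; apply: map_f; rewrite mem_iota.
by apply/mapP => -[i]; rewrite mem_iota /= => lei xE; have := xp i lei; rewrite xE eqxx.
Qed.

Lemma off_path_rev (p : nat -> G) (x : G) :
  off_path p x -> off_path (fun i => p (k - i)) x.
Proof. by move=> /off_pathP xp; apply/off_pathP => i _; apply/xp/leq_subr. Qed.

(** The triangle on [x], [p 0], [p 1] already has [p 2] attached at [p 1], so nothing else attaches
    at [x], not even [p 2] itself. *)
Lemma head_triangle_nbrs (p : nat -> G) (x : G) : induced_path k p -> off_path p x ->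
  sedge x (p 0) -> sedge x (p 1) -> forall j, j <= k -> sedge x (p j) = (j < 2).
Proof.
move=> pP /off_pathP xp x0 x1 [|[|j]] lej //; apply/negP => xj.
apply: (triangle_attach (a := p 1) (b := x) (c := p 0) (x := p 2) (y := p j.+2)).
- by rewrite sedge_sym.
- by [].
- by rewrite (pP 1 0 _ _).2 //; lia.
- by rewrite (pP 2 1 _ _).2 //; lia.
- by rewrite sedge_sym.
- exact: xp.
- by rewrite (pP 2 0 _ _).1 //; lia.
- by rewrite (pP j.+2 1 _ _).1 //; lia.
- by rewrite (pP j.+2 0 _ _).1 //; lia.
Qed.

(** Claw-freeness at [p j] makes [x] adjacent to a path neighbour of [p j]. In the resulting
    triangle both path vertices would have outside neighbours on the path unless one of them is an
    end. *)
Lemma inner_nbr (p : nat -> G) (x : G) (j : nat) : induced_path k p -> off_path p x ->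
  0 < j < k -> sedge x (p j) -> j = 1 /\ sedge x (p 0) \/ j.+1 = k /\ sedge x (p k).
Proof.
move=> pP /off_pathP xp /andP[j_gt0 ltj] xj.
have E i l : i <= k -> l <= k -> sedge (p i) (p l) = (l == i.+1) || (i == l.+1).
  by move=> lei lel; have [] := pP i l lei lel.
have N i l : i <= k -> l <= k -> (p i == p l) = (i == l).
  by move=> lei lel; have [] := pP i l lei lel.
have := @claw_free (p j) (p j.-1) (p j.+1) x.
rewrite !E ?N ?xp 1?(sedge_sym (p j) x) ?xj; try lia.
move=> /(_ ltac:(lia) ltac:(lia) isT ltac:(lia) isT isT) /or3P[|x'|x']; first lia.
  left; suff j1 : j = 1 by move: x'; rewrite j1 sedge_sym.
  apply/eqP; apply: contraT => j_neq1; exfalso.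
  apply: (triangle_attach (a := p j) (b := p j.-1) (c := x) (x := p j.+1) (y := p j.-2));
    rewrite ?E ?N ?xp // 1?sedge_sym //; lia.
right; suff jk : j.+1 = k by split=> //; move: x'; rewrite jk sedge_sym.
apply/eqP; apply: contraT => j_neqk; exfalso.
apply: (triangle_attach (a := p j) (b := p j.+1) (c := x) (x := p j.-1) (y := p j.+2));
  rewrite ?E ?N ?xp // 1?sedge_sym //; lia.
Qed.

Lemma no_head_extension (p : nat -> G) (x : G) : induced_path k p -> off_path p x ->
  sedge x (p 0) -> (forall j, 0 < j <= k -> ~~ sedge x (p j)) -> False.
Proof.
move=> pP /off_pathP xp x0 xN; apply: (k_max (q := fun i => if i is i'.+1 then p i' else x)).
have xE j : j <= k -> sedge x (p j) = (j == 0).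
  by case: j => [|j] lej; [rewrite x0 | apply/negbTE/xN].
move=> [|i] [|j] lei lej.
- by rewrite eqxx sedge_irr.
- by rewrite eq_sym (negPf (xp j _)) // xE // orbF.
- by rewrite (negPf (xp i _)) // sedge_sym xE.
- exact: pP.
Qed.

(** Without a triangle at an end, [inner_nbr] rules out inner neighbours, and a single adjacent end
    would lengthen the path. The reversed path transfers each claim about the head to the tail. *)
Lemma path_nbrs (p : nat -> G) (x : G) : induced_path k p -> off_path p x ->
  (exists2 i, i <= k & sedge x (p i)) ->
  [\/ forall j, j <= k -> sedge x (p j) = (j < 2),
      forall j, j <= k -> sedge x (p j) = (k <= j.+1)
    | forall j, j <= k -> sedge x (p j) = (j == 0) || (j == k)].
Proof.
move=> pP xp [i lei xi]; have rP := induced_path_rev pP; have xr := off_path_rev xp.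
case: (boolP (sedge x (p 0) && sedge x (p 1))) => [/andP[x0 x1]|N01].
  by constructor 1; apply: head_triangle_nbrs.
case: (boolP (sedge x (p k) && sedge x (p k.-1))) => [/andP[xk xk1]|Nk].
  constructor 2 => j lej; have := head_triangle_nbrs rP xr.
  rewrite subn0 subn1 => /(_ xk xk1 (k - j) (leq_subr _ _)); rewrite subKn // => ->; lia.
have inner j : 0 < j < k -> ~~ sedge x (p j).
  move=> ltj; apply/negP => xj; case: (inner_nbr pP xp ltj xj) => [[j1 x0]|[jk xk]].
    by move: N01; rewrite x0 -j1 xj.
  by move: Nk; rewrite -{2}jk xk xj.
case x0: (sedge x (p 0)); case xk: (sedge x (p k)).
- constructor 3 => j lej; case: (eqVneq j 0) => [->|j0] //=.
  by case: (eqVneq j k) => [->|jk] //; apply/negbTE/inner; lia.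
- exfalso; apply: (no_head_extension pP xp x0) => j lej.
  by case: (eqVneq j k) => [->|jk]; [rewrite xk | apply: inner; lia].
- exfalso; apply: (no_head_extension rP xr) => [|j lej]; first by rewrite subn0.
  by case: (eqVneq j k) => [->|jk]; [rewrite subnn x0 | apply: inner; lia].
- case: (eqVneq i 0) => [i0|i0]; first by rewrite i0 x0 in xi.
  case: (eqVneq i k) => [ik|ik]; first by rewrite ik xk in xi.
  by have := inner i; rewrite xi => /(_ ltac:(lia)).
Qed.

(** First, no further vertex [z] has a neighbour on the path; then a neighbour [z] of [x] would
    acquire one by claw-freeness at [x], whose neighbours [p 0] and [p k] are not adjacent. *)
Lemma cycle_closed (p : nat -> G) (x : G) : induced_path k p -> off_path p x ->
  (forall j, j <= k -> sedge x (p j) = (j == 0) || (j == k)) ->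
  forall y, ~~ off_path p y || (y == x).
Proof.
move=> pP xp xE.
have E i l : i <= k -> l <= k -> sedge (p i) (p l) = (l == i.+1) || (i == l.+1).
  by move=> lei lel; have [] := pP i l lei lel.
have N i l : i <= k -> l <= k -> (p i == p l) = (i == l).
  by move=> lei lel; have [] := pP i l lei lel.
have /off_pathP xN := xp.
have no_nbr z : off_path p z -> z != x -> ~ exists2 i, i <= k & sedge z (p i).
  move=> zp zx /(path_nbrs pP zp); move/off_pathP: zp => zN [] zE.
  - apply: (triangle_attach (a := p 0) (b := p 1) (c := z) (x := x) (y := p 2));
      rewrite ?E ?N ?xE ?(sedge_sym _ z) ?zE ?zN ?(eq_sym x) ?xN ?zx //; lia.
  - apply: (triangle_attach (a := p k) (b := p k.-1) (c := z) (x := x) (y := p k.-2));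
      rewrite ?E ?N ?xE ?(sedge_sym _ z) ?zE ?zN ?(eq_sym x) ?xN ?zx //; lia.
  (* If [z] also sees exactly both ends, then [x] and [z] are adjacent, and their edge lies in
     triangles with [p 0] and with [p k]. *)
  have := @claw_free (p 0) (p 1) x z.
  rewrite E ?(sedge_sym (p 0)) ?(sedge_sym (p 1)) ?xE ?zE ?xN ?zN 1?(eq_sym x) ?zx; try lia.
  move=> /(_ isT isT isT isT isT isT) /or3P[||xz]; try lia.
  suff /eqP : p 0 = p k by rewrite N //; lia.
  by apply: (one_triangle xz); rewrite ?xE ?zE ?eqxx ?orbT.
apply: (connected_ind (x := p 0)) => [|y z yS yz].
  by apply/orP; left; apply/negP => /off_pathP/(_ 0 isT); rewrite eqxx.
rewrite -implybE; apply/implyP => zp; apply: contraT => zx.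
have {}no_nbr := no_nbr z zp zx; exfalso; apply: no_nbr.
case/orP: yS => [|/eqP yE].
  rewrite negbK => /mapP[i]; rewrite mem_iota => lei yE.
  by exists i => //; rewrite sedge_sym -yE.
have /off_pathP zN := zp.
have := @claw_free x (p 0) (p k) z; rewrite !xE ?eqxx ?orbT // -yE yz N ?zN //.
rewrite E // => /(_ isT isT isT ltac:(lia) isT isT) /or3P[|h|h]; first lia.
  by exists 0; rewrite // sedge_sym.
by exists k; rewrite // sedge_sym.
Qed.

Lemma cycle_case (p : nat -> G) (x : G) : induced_path k p -> off_path p x ->
  (forall j, j <= k -> sedge x (p j) = (j == 0) || (j == k)) ->
  exists2 m : nat, 2 <= m & embeds G (cycle_graph (2 * m)).
Proof.
move=> pP xp xE; have closed_px := cycle_closed pP xp xE.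
(* The [k.+1] path vertices come first and [x] closes the cycle at index [k.+1]. For odd [k],
   [k >= 3] and this is an odd hole. *)
pose g (i : 'I_k.+2) := if i <= k then p i else x.
have gE (i j : 'I_k.+2) : sedge (g i) (g j) = @sedge (cycle_graph k.+2) i j.
  rewrite sedge_ordE !modnS_ord // /g; case: i j => [i lti] [j ltj] /=.
  case: (leqP i k) => lei; case: (leqP j k) => lej.
  - have [_ ->] := pP i j lei lej; rewrite !eqSS [i == k.+1]ltn_eqF // [j == k.+1]ltn_eqF //; lia.
  - have -> : j = k.+1 by lia.
    by rewrite sedge_sym xE // eqxx; case: ifP => /eqP; lia.
  - have -> : i = k.+1 by lia.
    by rewrite xE // eqxx; case: ifP => /eqP; lia.
  - rewrite sedge_irr (_ : i = j) ?eqxx //; lia.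
case: (boolP (odd k)) => [k_odd|k_even].
  exfalso; apply: (G_free (@Forbid_odd_hole k.+2 _ _)); rewrite /= ?negbK //; first lia.
  apply/induced_subgraphP; exists g => // i j; rewrite /g => gij; apply/val_inj => /=.
  case: i j gij => [i lti] [j ltj] /=; move/off_pathP: xp => xN.
  case: (leqP i k) => lei; case: (leqP j k) => lej; last lia.
  - by move/eqP; have [-> _] := pP i j lei lej => /eqP.
  - by move/eqP; rewrite (negPf (xN i _)).
  - by move/esym/eqP; rewrite (negPf (xN j _)).
have kE : k.+2 = 2 * k.+2./2 by lia.
exists k.+2./2; first lia.
rewrite -kE; apply: (@embeds_section G (cycle_graph k.+2) g xpredT) => [y|i j _ _]; last exact: gE.
case/orP: (closed_px y) => [|/eqP->].
  rewrite negbK => /mapP[i]; rewrite mem_iota => lei ->.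
  have lti : i < k.+2 by lia.
  by exists (Ordinal lti) => //; rewrite /g /= ifT //; lia.
by exists ord_max => //; rewrite /g /= ltnn.
Qed.

Lemma butterfly_case (p : nat -> G) : induced_path k p ->
  (forall x, off_path p x -> ~ forall j, j <= k -> sedge x (p j) = (j == 0) || (j == k)) ->
  exists n : nat, embeds G (butterfly n).
Proof.
move=> pP noC.
have E i l : i <= k -> l <= k -> sedge (p i) (p l) = (l == i.+1) || (i == l.+1).
  by move=> lei lel; have [] := pP i l lei lel.
have N i l : i <= k -> l <= k -> (p i == p l) = (i == l).
  by move=> lei lel; have [] := pP i l lei lel.
(* [A] and [B] are the tips of triangles on the first and last edge of the path. Tips have no
   neighbours off the path, so by connectedness they and the path cover [G]. *)
pose A x := [&& off_path p x, sedge x (p 0) & sedge x (p 1)].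
pose B x := [&& off_path p x, sedge x (p k) & sedge x (p k.-1)].
have AE x : A x -> forall j, j <= k -> sedge x (p j) = (j < 2).
  by move=> /and3P[xp x0 x1]; apply: head_triangle_nbrs.
have BE x : B x -> forall j, j <= k -> sedge x (p j) = (k <= j.+1).
  move=> /and3P[xp xk xk1]; have [|||] // := path_nbrs pP xp.
  - by exists k.
  - by move=> xE; move: xk; rewrite xE //; lia.
  - by move=> xE; have := noC x xp xE.
have AB x : off_path p x -> (exists2 i, i <= k & sedge x (p i)) -> A x || B x.
  move=> xp /(path_nbrs pP xp) [] xE; last by have := noC x xp xE.
  - by rewrite /A xp !xE //; lia.
  - by rewrite /B xp !xE ?leqnn ?orbT //; lia.
have A_end x z : A x -> off_path p z -> ~~ sedge z x.
  move=> Ax /off_pathP zN; apply/negP => zx; have /andP[/off_pathP xN _] := Ax.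
  apply: (triangle_attach (a := p 1) (b := x) (c := p 0) (x := p 2) (y := z));
    rewrite ?E ?N ?(sedge_sym (p _) x) ?(AE x) ?xN 1?(eq_sym z) ?zN //; lia.
have B_end x z : B x -> off_path p z -> ~~ sedge z x.
  move=> Bx /off_pathP zN; apply/negP => zx; have /andP[/off_pathP xN _] := Bx.
  apply: (triangle_attach (a := p k.-1) (b := x) (c := p k) (x := p k.-2) (y := z));
    rewrite ?E ?N ?(sedge_sym (p _) x) ?(BE x) ?xN 1?(eq_sym z) ?zN //; lia.
have cover y : [|| ~~ off_path p y, A y | B y].
  move: y; apply: (connected_ind (x := p 0)) => [|y z yS yz].
    by apply/orP; left; apply/negP => /off_pathP/(_ 0 isT); rewrite eqxx.
  rewrite -implybE; apply/implyP => zp; case/or3P: yS => [|Ay|By].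
  - rewrite negbK => /mapP[i]; rewrite mem_iota => lei yE.
    by apply: AB => //; exists i => //; rewrite sedge_sym -yE.
  - by have := A_end _ _ Ay zp; rewrite sedge_sym yz.
  - by have := B_end _ _ By zp; rewrite sedge_sym yz.
(* Each kind has at most one tip, by [one_triangle]. The default [p 0] stands for a missing tip,
   whose index [D] below excludes. *)
pose a := odflt (p 0) [pick x | A x]; pose b := odflt (p 0) [pick x | B x].
have aP x : A x -> A a /\ a = x.
  move=> Ax; have Aa : A a.
    by rewrite /a; case: pickP => [|/(_ x)] //=; rewrite Ax.
  split=> //; apply: (one_triangle (a := p 0) (b := p 1)); rewrite ?E //; try lia;
    by rewrite sedge_sym AE //; lia.
have bP x : B x -> B b /\ b = x.
  move=> Bx; have Bb : B b.
    by rewrite /b; case: pickP => [|/(_ x)] //=; rewrite Bx.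
  split=> //; apply: (one_triangle (a := p k) (b := p k.-1)); rewrite ?E //; try lia;
    by rewrite sedge_sym BE //; lia.
(* The butterfly has [k.+3] vertices: 0 for [a], then the path shifted by one, then [k.+2] for
   [b]. *)
exists (k - 2).
pose g (i : 'I_(k - 2 + 5)) := if i == 0 :> nat then a else if i == k.+2 :> nat then b else p i.-1.
pose D (i : 'I_(k - 2 + 5)) := ((i == 0 :> nat) ==> A a) && ((i == k.+2 :> nat) ==> B b).
apply: (@embeds_section G (butterfly (k - 2)) g D) => [y|i j].
  have kE : k - 2 + 5 = k.+3 by lia.
  case/or3P: (cover y) => [|/aP[Aa <-]|/bP[Bb <-]].
  - rewrite negbK => /mapP[i]; rewrite mem_iota => lei ->.
    have lti : i.+1 < k - 2 + 5 by lia.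
    have iNk : (i.+1 == k.+2) = false by lia.
    by exists (Ordinal lti); rewrite /D /g /= iNk.
  - have lt0 : 0 < k - 2 + 5 by lia.
    by exists (Ordinal lt0); rewrite /D /g //= Aa.
  - have ltk : k.+2 < k - 2 + 5 by lia.
    by exists (Ordinal ltk); rewrite /D /g /= eqxx.
case: i j => [i lti] [j ltj]; rewrite !unfold_in /D /g sedge_ordE /= => {g D}.
have {}lti : i <= k.+2 by lia.
have {}ltj : j <= k.+2 by lia.
case: (eqVneq i 0) => [->|i0]; case: (eqVneq j 0) => [->|j0] /=.
- by rewrite sedge_irr.
- rewrite andbT; case: (eqVneq j k.+2) => [->|jk] /= Aa Bb.
    have /andP[bp _] := Bb; rewrite sedge_sym (negPf (A_end _ _ Aa bp)); lia.
  rewrite AE //; lia.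
- rewrite andbT; case: (eqVneq i k.+2) => [->|ik] /= Bb Aa.
    have /andP[bp _] := Bb; rewrite (negPf (A_end _ _ Aa bp)); lia.
  rewrite sedge_sym AE //; lia.
case: (eqVneq i k.+2) => [->|ik]; case: (eqVneq j k.+2) => [->|jk] /=.
- by rewrite sedge_irr ?eqxx.
- move=> Bb _; rewrite BE //; lia.
- move=> _ Bb; rewrite sedge_sym BE //; lia.
move=> _ _; rewrite E; lia.
Qed.

End LongestPath.
End OneTriangle.

(** * Classification of the connected free graphs *)

Theorem connected_free_shape :
  [\/ embeds G (complete_graph 5), embeds G diamond,
      exists2 m : nat, 2 <= m & embeds G (cycle_graph (2 * m))
    | exists n : nat, embeds G (butterfly n)].
Proof.
case: dense_or_one_triangle => [K5|D|one_triangle]; [by constructor 1|by constructor 2|].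
(* Without an induced path on three vertices, being equal or adjacent to [x] spreads along edges, so
   [G] is complete; otherwise that path starts the search for a longest one, with [k >= 2]. *)
case: (boolP [exists u : G, exists v : G, exists w : G,
  [&& sedge u v, sedge v w, u != w & ~~ sedge u w]]) => [|noP3]; last first.
  constructor 1; apply: clique_embeds => x y xy.
  suff : (y == x) || sedge x y by rewrite eq_sym (negPf xy).
  move: y {xy}; apply: (connected_ind (x := x)) => [|y z]; first by rewrite eqxx.
  case/orP=> [/eqP->->|xy yz]; first by rewrite orbT.
  apply: contraNT noP3; rewrite negb_or => /andP[zx xz].
  by apply/existsP; exists x; apply/existsP; exists y; apply/existsP; exists z;
    rewrite xy yz xz eq_sym zx.
move=> /existsP[u /existsP[v /existsP[w /and4P[uv vw uw uwN]]]].
have [|k [p [k_ge2 pP k_max]]] := @longest_induced_path 2 (nth u [:: u; v; w]).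
  move=> [|[|[|//]]] [|[|[|//]]] _ _ /=;
    rewrite ?eqxx ?sedge_irr ?(eq_sym v u) ?(eq_sym w) ?(negPf (sedgeN uv)) ?(negPf (sedgeN vw))
      ?(negPf uw) ?(sedge_sym v u) ?(sedge_sym w) ?uv ?vw ?(negPf uwN) //.
case: (boolP [exists x, off_path k p x &&
    [forall j : 'I_k.+1, sedge x (p j) == ((j == 0 :> nat) || (j == k :> nat))]]).
  move=> /existsP[x /andP[xp /forallP xE]]; constructor 3.
  apply: (cycle_case one_triangle k_ge2 k_max pP xp) => j lej.
  by have /eqP := xE (Ordinal (lej : j < k.+1)).
move=> noC; constructor 4; apply: (butterfly_case one_triangle k_ge2 k_max pP) => x xp xE.
case/negP: noC; apply/existsP; exists x; rewrite xp; apply/forallP => j.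
by rewrite xE // -ltnS.
Qed.

End Structure.

Theorem proposition24 (G : sgraph) :
  [<-> exists c : {set G} -> colour, cg_free mono_P3_K3 (@CGraph G c);
       forall C : {set G}, C \in components G ->
         [\/ induced_subgraph_of (induced C) (complete_graph 5),
             induced_subgraph_of (induced C) diamond,
             exists2 m : nat, 2 <= m &
               induced_subgraph_of (induced C) (cycle_graph (2 * m))
           | exists n : nat,
               induced_subgraph_of (induced C) (butterfly n)];
       free forbidden G].
Proof.
have free_shape : free forbidden G -> forall C : {set G}, C \in components G ->
    [\/ induced_subgraph_of (induced C) (complete_graph 5),
        induced_subgraph_of (induced C) diamond,
        exists2 m : nat, 2 <= m & induced_subgraph_of (induced C) (cycle_graph (2 * m))
      | exists n : nat, induced_subgraph_of (induced C) (butterfly n)].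
  (* Freeness passes to induced subgraphs, so the connected case applies to each component. *)
  move=> G_free C CG; have C_free : free forbidden (induced C).
    move=> H forbH /induced_subgraphP HC; apply: (G_free H forbH).
    exact/induced_subgraphP/(embeds_trans HC)/embeds_induced.
  case: (connected_free_shape C_free (component_connected CG)) => [||[m m_ge2]|[n]] emb.
  - by constructor 1; apply/induced_subgraphP.
  - by constructor 2; apply/induced_subgraphP.
  - by constructor 3; exists m => //; apply/induced_subgraphP.
  - by constructor 4; exists n; apply/induced_subgraphP.
(* Each implication of the cycle is composed of two of the proved ones: (1) to (3), (3) to (2) and
   (2) to (1). *)
tfae.
- by move=> /colourableP/colourable_free/free_shape.
- by move=> /components_embed_colourable/colourable_free.
- by move=> /free_shape/components_embed_colourable/colourableP.
Qed.
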